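(* Let $R$ be a commutative ring with identity. The following assertions are equivalent: (1) $R$ is a $\tau_q$-VN regular ring; (2) for any finitely generated ideal $K$ of $R$, there exists an $I\in\mathcal{Q}$ such that $IK=K^2$; (3) $R_{\mathfrak m}$ is a von Neumann regular ring for any $\mathfrak m\in q\text{-}\mathrm{Max}(R)$; (4) $\mathrm{T}(R[x])$ is a von Neumann regular ring; (5) $R$ is a reduced ring and $\mathrm{Min}(R)$ is compact.
   Context: All rings are commutative with identity. An ideal $I$ of $R$ is dense if $(0:_R I)=\{r\in R\mid Ir=0\}=0$, and semi-regular if it contains a finitely generated dense sub-ideal. $\mathcal{Q}$ denotes the set of all finitely generated semi-regular ideals of $R$. $q\text{-}\mathrm{Max}(R)$ is the set of maximal $q$-ideals of $R$, which are exactly the ideals of $R$ maximal among the non-semi-regular ideals; these are prime. An $R$-homomorphism $f:M\to N$ is a $\tau_q$-monomorphism if $f_{\mathfrak m}:M_{\mathfrak m}\to N_{\mathfrak m}$ is a monomorphism for any $\mathfrak m\in q\text{-}\mathrm{Max}(R)$. An $R$-module $M$ is $\tau_q$-flat if, for any $\tau_q$-monomorphism $f:A\to B$ of $R$-modules, $1_M\otimes f:M\otimes_R A\to M\otimes_R B$ is a $\tau_q$-monomorphism. $R$ is a $\tau_q$-VN regular ring if all $R$-modules are $\tau_q$-flat. $\mathrm{T}(A)$ denotes the total quotient ring of a ring $A$ (localization at all regular elements), and $\mathrm{Min}(R)$ the set of minimal prime ideals of $R$ with the topology induced from the Zariski topology of $\mathrm{Spec}(R)$. *)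

(* Defs.v *)
From HB Require Import structures.
From mathcomp Require Import all_boot all_order all_algebra generic_quotient.
From mathcomp Require Import ring.
From mathcomp Require Import all_classical topology.

Set Implicit Arguments.
Unset Strict Implicit.
Unset Printing Implicit Defensive.

Import GRing.Theory.
Local Open Scope classical_set_scope.
Local Open Scope ring_scope.
Local Open Scope quotient_scope.

Section Ideals.
Variable R : comPzRingType.
Implicit Types (E I J m : set R) (r x y : R).

Definition is_ideal I : Prop :=
  [/\ I 0, forall x y, I x -> I y -> I (x + y) & forall r x, I x -> I (r * x)].

Definition ideal_span E : set R := smallest is_ideal E.

Definition fg_ideal I : Prop := exists s : seq R, I = ideal_span [set` s].

Definition ideal_mul I J : set R := ideal_span [set x * y | x in I & y in J].

Definition annihilator I : set R := [set r | forall x, I x -> x * r = 0].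

Definition dense_ideal I : Prop := annihilator I = [set 0].

Definition semiregular I : Prop :=
  exists J, [/\ fg_ideal J, dense_ideal J & J `<=` I].

(* the set written \mathcal{Q} in the literature *)
Definition fg_semiregular : set (set R) :=
  [set I | fg_ideal I /\ semiregular I].

Definition is_prime_ideal m : Prop :=
  [/\ is_ideal m, ~ m 1 & forall x y, m (x * y) -> m x \/ m y].

(* maximal q-ideals are exactly the ideals maximal among the
   non-semi-regular ones *)
Definition is_max_q_ideal m : Prop :=
  [/\ is_ideal m, ~ semiregular m &
      forall J, is_ideal J -> ~ semiregular J -> m `<=` J -> J = m].

Lemma ideal_span_ideal E : is_ideal (ideal_span E).
Proof.
split=> [I [[] //]|x y Ex Ey I EI|r x Ex I EI].
- by have [[_ ID _] _] := EI; apply: ID; [apply: Ex|apply: Ey].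
- by have [[_ _ IM] _] := EI; apply: IM; apply: Ex.
Qed.

Lemma sub_ideal_span E : E `<=` ideal_span E.
Proof. by move=> x Ex I [_]; apply. Qed.

Lemma ideal_span_min E I : is_ideal I -> E `<=` I -> ideal_span E `<=` I.
Proof. by move=> idI EI x; apply. Qed.

Lemma dense_idealP I :
  dense_ideal I <-> forall r, (forall x, I x -> x * r = 0) -> r = 0.
Proof.
split=> [dI r Ir|dI]; first by have : annihilator I r by []; rewrite dI.
by apply/seteqP; split=> [r /dI//|r -> x _]; rewrite mulr0.
Qed.

Lemma annihilator_span E : annihilator (ideal_span E) = annihilator E.
Proof.
apply/seteqP; split=> r Er x Ex; first by apply: Er; apply: sub_ideal_span.
apply: (Ex [set y | y * r = 0]); split; last exact: Er.
split=> [|y z /= yr zr|z y /= yr]; first exact: mul0r.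
- by rewrite mulrDl yr zr addr0.
- by rewrite -mulrA yr mulr0.
Qed.

Lemma max_q_ideal_prime m : is_max_q_ideal m -> is_prime_ideal m.
Proof.
move=> [idm nsm maxm]; have [m0 mD mM] := idm.
have dense1 : dense_ideal (ideal_span [set` [:: 1 : R]]).
  apply/dense_idealP => r /(_ 1); rewrite mul1r; apply.
  by apply: sub_ideal_span => /=; rewrite mem_head.
split=> // [m1|a b mab].
  apply: nsm; exists (ideal_span [set` [:: 1 : R]]); split=> //; first by exists [:: 1].
  by apply: (ideal_span_min idm) => x /=; rewrite inE => /eqP->.
apply: contrapT => /not_orP[nma nmb].
pose up c := [set x : R | exists r, exists2 y, m y & x = y + r * c].
have key c : ~ m c -> semiregular (up c).
  move=> nmc; apply: contrapT => nsc; apply: nmc.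
  suff <- : up c = m by exists 1, 0; rewrite // mul1r add0r.
  apply: maxm => // [|x mx]; last by exists 0, x; rewrite // mul0r addr0.
  split; first by exists 0, 0; rewrite // mul0r addr0.
    move=> _ _ [r [x mx ->]] [s [y my ->]]; exists (r + s), (x + y); first exact: mD.
    by rewrite mulrDl addrACA.
  move=> s _ [r [x mx ->]]; exists (s * r), (s * x); first exact: mM.
  by rewrite mulrDr mulrA.
have [_ [[s ->] ds sa]] := key a nma; have [_ [[t ->] dt tb]] := key b nmb.
apply: nsm; exists (ideal_span [set` [seq x * y | x <- s, y <- t]]); split.
- by eexists.
- move: ds dt; rewrite /dense_ideal !annihilator_span.
  rewrite -!/(dense_ideal _) !dense_idealP => ds dt r rst.
  apply: dt => y yt; apply: ds => x xs; rewrite mulrA; apply: rst.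
  by apply/allpairsP; exists (x, y).
- apply: ideal_span_min => // _ /= /allpairsP[[x y] /= [xs yt ->]].
  have /sa[r [u mu ->]] := @sub_ideal_span [set` s] x xs.
  have /tb[q [v mv ->]] := @sub_ideal_span [set` t] y yt.
  rewrite mulrDr mulrDl; apply: (mD); last first.
    rewrite mulrDl; apply: (mD); first by rewrite mulrC; apply: mM.
    by rewrite mulrACA; apply: mM.
  by rewrite addrC; apply: (mD); rewrite [_ * v]mulrC ?[v * _]mulrC; apply: (mM).
Qed.

End Ideals.

Record prime_ideal (R : comPzRingType) := PrimeIdeal {
  prime_set :> set R;
  prime_setP : is_prime_ideal prime_set }.

Record q_Max (R : comPzRingType) := QMax {
  qmax_set :> set R;
  qmax_setP : is_max_q_ideal qmax_set }.

Coercion prime_of_qMax (R : comPzRingType) (m : q_Max R) : prime_ideal R :=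
  PrimeIdeal (max_q_ideal_prime (qmax_setP m)).

Section Spectrum.
Variable R : comPzRingType.

HB.instance Definition _ := gen_eqMixin (prime_ideal R).
HB.instance Definition _ := gen_choiceMixin (prime_ideal R).

Definition zariski_open : set (set (prime_ideal R)) :=
  [set U | exists E : set R, U = [set p : prime_ideal R | ~ (E `<=` p)]].

Let zariski_openT : zariski_open setT.
Proof.
exists setT; apply/seteqP; split=> // p _ /(_ 1 I).
by have [_ p1 _] := prime_setP p.
Qed.

Let zariski_openI : setI_closed zariski_open.
Proof.
move=> _ _ [E ->] [F ->]; exists [set x * y | x in E & y in F].
apply/seteqP; split=> p /=; have [[p0 pD pM] p1 pP] := prime_setP p.
- move=> [/existsNP[x /not_implyP[Ex px]] /existsNP[y /not_implyP[Fy py]]] EFp.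
  by have /EFp/pP[] : [set x * y | x in E & y in F] (x * y) by exists x => //; exists y.
- move=> nEF; split=> sub; apply: nEF => _ [x Ex [y Fy <-]]; last exact/pM/sub.
  by rewrite mulrC; apply/pM/sub.
Qed.

Let zariski_open_bigU (I : Type) (f : I -> set (prime_ideal R)) :
  (forall i, zariski_open (f i)) -> zariski_open (\bigcup_i f i).
Proof.
move=> /choice[E fE]; exists (\bigcup_i E i); apply/seteqP; split=> p /=.
- by move=> [i _]; rewrite fE /= => nE sub; apply: nE => x Ex; apply: sub; exists i.
- move=> /existsNP[x /not_implyP[[i _ Ex] px]]; exists i => //.
  by rewrite fE /= => /(_ x Ex).
Qed.

HB.instance Definition _ := isOpenTopological.Build (prime_ideal R)
  zariski_openT zariski_openI zariski_open_bigU.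

Definition min_primes : set (prime_ideal R) :=
  [set p | forall q : prime_ideal R, q `<=` p -> q = p :> set R].

End Spectrum.

Record mulset (R : comPzRingType) := MulSet {
  mset :> set R;
  mset1 : mset 1;
  msetM : forall s t, mset s -> mset t -> mset (s * t) }.

Section MulSets.
Variable R : comPzRingType.

Lemma prime_compl1 (p : prime_ideal R) : (~` p) 1.
Proof. by case: (prime_setP p). Qed.

Lemma prime_complM (p : prime_ideal R) s t :
  (~` p) s -> (~` p) t -> (~` p) (s * t).
Proof. by case: (prime_setP p) => _ _ pP ps pt /pP[]. Qed.

Definition prime_compl (p : prime_ideal R) : mulset R :=
  MulSet (@prime_compl1 p) (@prime_complM p).

Definition regular : set R := [set s | forall r, s * r = 0 -> r = 0].

Lemma regular1 : regular 1.
Proof. by move=> r; rewrite mul1r. Qed.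

Lemma regularM s t : regular s -> regular t -> regular (s * t).
Proof. by move=> rs rt r; rewrite -mulrA => /rs/rt. Qed.

Definition regular_mulset : mulset R := MulSet regular1 regularM.

End MulSets.

Section Localization.
Variables (R : comPzRingType) (S : mulset R).

Definition den (s : set_type S) : R := val s.

Lemma denP s : mset S (den s). Proof. exact/set_mem/valP. Qed.

Definition den1 : set_type S := exist _ 1 (mem_set (mset1 S)).
Definition denM (s t : set_type S) : set_type S :=
  exist _ (den s * den t) (mem_set (msetM (denP s) (denP t))).

Lemma den1E : den den1 = 1. Proof. by []. Qed.
Lemma denME s t : den (denM s t) = den s * den t. Proof. by []. Qed.

Section Module.
Variable M : lmodType R.
Implicit Types (x y : M) (s t : set_type S).

Definition loc_rel (u v : M * set_type S) : bool :=
  `[< exists2 w, mset S w & w *: (den v.2 *: u.1) = w *: (den u.2 *: v.1) >].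

Lemma loc_rel_refl : reflexive loc_rel.
Proof. by move=> u; apply/asboolP; exists 1; first exact: mset1. Qed.

Lemma loc_rel_sym : symmetric loc_rel.
Proof. by move=> u v; apply/asboolP/asboolP => -[w Sw e]; exists w. Qed.

Lemma loc_rel_trans : transitive loc_rel.
Proof.
move=> [y t] [x s] [z u] /asboolP[w Sw /= e] /asboolP[w' Sw' /= e'].
apply/asboolP; exists (w * w' * den t) => /=.
  by apply: msetM; [exact: msetM|exact: denP].
move/(congr1 ( *:%R (w' * den u))): e; move/(congr1 ( *:%R (w * den s))): e'.
rewrite !scalerA => e' e.
transitivity ((w' * den u * w * den t) *: x); first by congr (_ *: _); ring.
rewrite e; transitivity ((w * den s * w' * den u) *: y).
  by congr (_ *: _); ring.
by rewrite e'; congr (_ *: _); ring.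
Qed.

Canonical loc_equiv := EquivRel loc_rel loc_rel_refl loc_rel_sym loc_rel_trans.

Definition loc : Type := {eq_quot loc_equiv}.
HB.instance Definition _ := Choice.on loc.
HB.instance Definition _ := EqQuotient.on loc.

Definition frac x s : loc := \pi_loc (x, s).

Lemma frac_eq x s y t :
  frac x s = frac y t <->
  exists2 w, mset S w & w *: (den t *: x) = w *: (den s *: y).
Proof.
split=> [/eqP|e]; first by rewrite /frac eqmodE => /asboolP.
by apply/eqP; rewrite /frac eqmodE; apply/asboolP.
Qed.

Lemma frac_eq1 x s y t : den t *: x = den s *: y -> frac x s = frac y t.
Proof. by move=> e; apply/frac_eq; exists 1; [exact: mset1|rewrite e]. Qed.

Lemma frac_repr (a : loc) : frac (repr a).1 (repr a).2 = a.
Proof. by rewrite /frac -surjective_pairing reprK. Qed.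

Lemma fracP (a : loc) : exists x s, a = frac x s.
Proof. by exists (repr a).1, (repr a).2; rewrite frac_repr. Qed.

End Module.

Section ModuleOps.
Variable M : lmodType R.
Implicit Types (x y : M) (s t : set_type S) (a b : loc M).

Definition loc0 : loc M := frac 0 den1.

Definition loc_add a b : loc M :=
  let: (x, s) := repr a in let: (y, t) := repr b in
  frac (den t *: x + den s *: y) (denM s t).

Definition loc_opp a : loc M := let: (x, s) := repr a in frac (- x) s.

Definition loc_scale (c : loc R^o) a : loc M :=
  let: (r, s) := repr c in let: (x, t) := repr a in
  frac ((r : R) *: x) (denM s t).

Lemma loc_addE x s y t : loc_add (frac x s) (frac y t) =
  frac (den t *: x + den s *: y) (denM s t).
Proof.
rewrite /loc_add.
case: (repr _) (frac_repr (frac x s)) => x' s' /= /frac_eq[w Sw e].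
case: (repr _) (frac_repr (frac y t)) => y' t' /= /frac_eq[v Sv f].
apply/frac_eq; exists (w * v); first exact: msetM.
move: e f; rewrite !scalerDr !scalerA => e f; congr (_ + _).
  transitivity ((v * den t * den t') *: ((w * den s) *: x')).
    by rewrite scalerA; congr (_ *: _); rewrite !denME; ring.
  by rewrite e scalerA; congr (_ *: _); rewrite !denME; ring.
transitivity ((w * den s * den s') *: ((v * den t) *: y')).
  by rewrite scalerA; congr (_ *: _); rewrite !denME; ring.
by rewrite f scalerA; congr (_ *: _); rewrite !denME; ring.
Qed.

Lemma loc_oppE x s : loc_opp (frac x s) = frac (- x) s.
Proof.
rewrite /loc_opp.
case: (repr _) (frac_repr (frac x s)) => x' s' /= /frac_eq[w Sw e].
by apply/frac_eq; exists w; rewrite // !scalerN e.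
Qed.

Lemma loc_scaleE (r : R^o) s x t :
  loc_scale (frac r s) (frac x t) = frac ((r : R) *: x) (denM s t).
Proof.
rewrite /loc_scale.
case: (repr _) (frac_repr (frac r s)) => r' s' /= /frac_eq[w Sw e].
case: (repr _) (frac_repr (frac x t)) => x' t' /= /frac_eq[v Sv f].
apply/frac_eq; exists (w * v); first exact: msetM.
move: e f; rewrite !denME !scalerA => e f.
have {}e : w * den s * r' = w * den s' * r by [].
transitivity ((w * den s * r') *: ((v * den t) *: x')).
  by rewrite scalerA; congr (_ *: _); ring.
by rewrite e f scalerA; congr (_ *: _); ring.
Qed.

Let loc_addA : associative loc_add.
Proof.
move=> a b c; have [x [s ->]] := fracP a; have [y [t ->]] := fracP b.
have [z [u ->]] := fracP c; rewrite !loc_addE; apply: frac_eq1.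
by rewrite !denME !scalerDr !scalerA addrA; congr (_ *: _ + _ *: _ + _ *: _); ring.
Qed.

Let loc_addC : commutative loc_add.
Proof.
move=> a b; have [x [s ->]] := fracP a; have [y [t ->]] := fracP b.
by rewrite !loc_addE; apply: frac_eq1; rewrite !denME addrC [_ * den s]mulrC.
Qed.

Let loc_add0 : left_id loc0 loc_add.
Proof.
move=> a; have [x [s ->]] := fracP a; rewrite loc_addE; apply: frac_eq1.
by rewrite denME den1E scaler0 add0r scale1r mul1r.
Qed.

Let loc_addN : left_inverse loc0 loc_opp loc_add.
Proof.
move=> a; have [x [s ->]] := fracP a; rewrite loc_oppE loc_addE.
by apply: frac_eq1; rewrite scalerN addNr !scaler0.
Qed.

HB.instance Definition _ := GRing.isZmodule.Build (loc M)
  loc_addA loc_addC loc_add0 loc_addN.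

Lemma fracD x s y t :
  frac x s + frac y t = frac (den t *: x + den s *: y) (denM s t).
Proof. exact: loc_addE. Qed.

Lemma frac0 s : frac 0 s = 0 :> loc M.
Proof. by apply: frac_eq1; rewrite !scaler0. Qed.

End ModuleOps.

Definition loc_ring : Type := loc R^o.
HB.instance Definition _ := GRing.Zmodule.on loc_ring.

Let loc_mul (a b : loc_ring) : loc_ring := loc_scale a b.
Let loc_one : loc_ring := frac (1 : R^o) den1.

Let loc_mulE (r q : R^o) (s t : set_type S) :
  loc_mul (frac r s) (frac q t) = frac ((r : R) * q : R^o) (denM s t).
Proof. exact: loc_scaleE. Qed.

Let loc_mulA : associative loc_mul.
Proof.
move=> a b c; have [x [s ->]] := fracP a; have [y [t ->]] := fracP b.
have [z [u ->]] := fracP c; rewrite !loc_mulE; apply: frac_eq1.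
by rewrite ?denME ?den1E /GRing.scale /=; ring.
Qed.

Let loc_mulC : commutative loc_mul.
Proof.
move=> a b; have [x [s ->]] := fracP a; have [y [t ->]] := fracP b.
by rewrite !loc_mulE; apply: frac_eq1; rewrite ?denME ?den1E /GRing.scale /=; ring.
Qed.

Let loc_mul1 : left_id loc_one loc_mul.
Proof.
move=> a; have [x [s ->]] := fracP a; rewrite loc_mulE; apply: frac_eq1.
by rewrite ?denME ?den1E /GRing.scale /=; ring.
Qed.

Let loc_mulDl : left_distributive loc_mul +%R.
Proof.
move=> a b c; have [x [s ->]] := fracP a; have [y [t ->]] := fracP b.
have [z [u ->]] := fracP c.
rewrite fracD !loc_mulE fracD; apply: frac_eq1.
by rewrite ?denME ?den1E /GRing.scale /=; ring.
Qed.

HB.instance Definition _ := GRing.Zmodule_isComPzRing.Build loc_ring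
  loc_mulA loc_mulC loc_mul1 loc_mulDl.

Lemma frac1 : frac (1 : R^o) den1 = 1 :> loc_ring.
Proof. by []. Qed.

Section ModuleStructure.
Variable M : lmodType R.

Let loc_scaleA (c d : loc_ring) (a : loc M) :
  loc_scale c (loc_scale d a) = loc_scale (c * d) a.
Proof.
have [r [s ->]] := fracP c; have [q [t ->]] := fracP d.
have [x [u ->]] := fracP a; rewrite [_ * _]loc_mulE !loc_scaleE.
by apply: frac_eq1; rewrite !denME !scalerA; congr (_ *: _); ring.
Qed.

Let loc_scale1 : left_id (1 : loc_ring) (@loc_scale M).
Proof.
move=> a; have [x [u ->]] := fracP a; rewrite -frac1 loc_scaleE.
by apply: frac_eq1; rewrite denME den1E scale1r mul1r.
Qed.

Let loc_scaleDr : right_distributive (@loc_scale M) +%R.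
Proof.
move=> c a b; have [r [s ->]] := fracP c; have [x [t ->]] := fracP a.
have [y [u ->]] := fracP b; rewrite fracD !loc_scaleE fracD.
apply: frac_eq1; rewrite !denME !scalerDr !scalerA.
by congr (_ *: _ + _ *: _); ring.
Qed.

Let loc_scaleDl (a : loc M) :
  {morph (@loc_scale M)^~ a : c d / (c : loc_ring) + d >-> c + d}.
Proof.
move=> c d; have [r [s ->]] := fracP c; have [q [t ->]] := fracP d.
have [x [u ->]] := fracP a; rewrite [X in loc_scale X]fracD !loc_scaleE fracD.
apply: frac_eq1; rewrite !denME scalerDl !scalerDr !scalerA.
by congr (_ *: _ + _ *: _); rewrite ?denME ?den1E /GRing.scale /=; ring.
Qed.

HB.instance Definition _ := GRing.Zmodule_isLmodule.Build loc_ring (loc M)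
  loc_scaleA loc_scale1 loc_scaleDr loc_scaleDl.

Lemma fracZ (r : R^o) (s : set_type S) (x : M) (t : set_type S) :
  (frac r s : loc_ring) *: frac x t = frac ((r : R) *: x) (denM s t).
Proof. exact: loc_scaleE. Qed.

End ModuleStructure.

Lemma fracM (r q : R^o) (s t : set_type S) :
  (frac r s : loc_ring) * (frac q t : loc_ring)
  = frac ((r : R) * q : R^o) (denM s t).
Proof. exact: loc_mulE. Qed.

Section LocalizedMap.
Variables (A B : lmodType R) (f : {linear A -> B}).

Definition loc_map (a : loc A) : loc B :=
  let: (x, s) := repr a in frac (f x) s.

Lemma loc_mapE (x : A) (s : set_type S) : loc_map (frac x s) = frac (f x) s.
Proof.
rewrite /loc_map.
case: (repr _) (frac_repr (frac x s)) => y t /= /frac_eq[w Sw e].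
apply/frac_eq; exists w => //; move/(congr1 f): e.
by rewrite !scalerA !linearZ.
Qed.

Let loc_map_linear : linear loc_map.
Proof.
move=> c a b; have [r [s ->]] := fracP c; have [x [t ->]] := fracP a.
have [y [u ->]] := fracP b; rewrite fracZ fracD !loc_mapE fracZ fracD.
by rewrite !scalerA linearD !linearZ /=.
Qed.

HB.instance Definition _ := GRing.isLinear.Build loc_ring (loc A) (loc B) _
  loc_map loc_map_linear.

End LocalizedMap.
End Localization.

Arguments loc {R} S M.
Arguments loc_map {R} S {A B} f.

Definition total_quotient_ring (R : comPzRingType) : comPzRingType :=
  loc_ring (regular_mulset R).

Section Tensor.
Variables (R : comPzRingType) (M A : lmodType R).

(* The tensor product is the commutative monoid presented by the generators
   (x, a) and the bilinearity relations; a list stands for the sum of its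
   elements. This monoid is the usual R-module, with opposite given by
   (x, a) |-> (- x, a). *)
Inductive tensor_rel : seq (M * A) -> seq (M * A) -> Prop :=
| tensor_refl l : tensor_rel l l
| tensor_sym l k : tensor_rel l k -> tensor_rel k l
| tensor_trans l k h : tensor_rel l k -> tensor_rel k h -> tensor_rel l h
| tensor_cat l l' k k' :
    tensor_rel l l' -> tensor_rel k k' -> tensor_rel (l ++ k) (l' ++ k')
| tensor_catC l k : tensor_rel (l ++ k) (k ++ l)
| tensor_zero : tensor_rel [:: (0, 0)] [::]
| tensor_addl x y a : tensor_rel [:: (x + y, a)] [:: (x, a); (y, a)]
| tensor_addr x a b : tensor_rel [:: (x, a + b)] [:: (x, a); (x, b)]
| tensor_scale r x a : tensor_rel [:: (r *: x, a)] [:: (x, r *: a)].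

Definition tensor_relb l k : bool := `[< tensor_rel l k >].

Let tensor_relb_refl : reflexive tensor_relb.
Proof. by move=> l; apply/asboolP; exact: tensor_refl. Qed.

Let tensor_relb_sym : symmetric tensor_relb.
Proof. by move=> l k; apply/asboolP/asboolP; exact: tensor_sym. Qed.

Let tensor_relb_trans : transitive tensor_relb.
Proof.
by move=> k l h /asboolP lk /asboolP kh; apply/asboolP; exact: tensor_trans kh.
Qed.

Canonical tensor_equiv :=
  EquivRel tensor_relb tensor_relb_refl tensor_relb_sym tensor_relb_trans.

Definition tensor : Type := {eq_quot tensor_equiv}.
HB.instance Definition _ := Choice.on tensor.
HB.instance Definition _ := EqQuotient.on tensor.

Definition tclass (l : seq (M * A)) : tensor := \pi_tensor l.

Lemma tclass_eq l k : tclass l = tclass k <-> tensor_rel l k.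
Proof.
split=> [/eqP|e]; first by rewrite /tclass eqmodE => /asboolP.
by apply/eqP; rewrite /tclass eqmodE; apply/asboolP.
Qed.

Lemma tclass_repr (u : tensor) : tclass (repr u) = u.
Proof. exact: reprK. Qed.

Definition tens_scale_seq r (l : seq (M * A)) := [seq (r *: u.1, u.2) | u <- l].

Lemma tensor_rel_scale r l k :
  tensor_rel l k -> tensor_rel (tens_scale_seq r l) (tens_scale_seq r k).
Proof.
elim=> [h|h k' _|h k' j _ + _|h h' k' k'' _ + _|h k'||x y a|x a b|q x a] /=.
- exact: tensor_refl.
- exact: tensor_sym.
- exact: tensor_trans.
- by rewrite /tens_scale_seq !map_cat; exact: tensor_cat.
- by rewrite /tens_scale_seq !map_cat; exact: tensor_catC.
- by rewrite scaler0; exact: tensor_zero.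
- by rewrite scalerDr; exact: tensor_addl.
- exact: tensor_addr.
- by rewrite scalerA mulrC -scalerA; exact: tensor_scale.
Qed.

Definition tens_add (u v : tensor) : tensor := tclass (repr u ++ repr v).
Definition tens_scale r (u : tensor) : tensor :=
  tclass (tens_scale_seq r (repr u)).

Lemma tens_addE l k : tens_add (tclass l) (tclass k) = tclass (l ++ k).
Proof.
by apply/tclass_eq/tensor_cat; apply/tclass_eq; rewrite tclass_repr.
Qed.

Lemma tens_scaleE r l : tens_scale r (tclass l) = tclass (tens_scale_seq r l).
Proof. by apply/tclass_eq/tensor_rel_scale/tclass_eq; rewrite tclass_repr. Qed.

Lemma tensor_zerol a : tensor_rel [:: (0, a)] [::].
Proof.
apply: tensor_trans tensor_zero; rewrite -[in X in tensor_rel X](scale0r 0).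
by rewrite -[X in tensor_rel _ [:: (_, X)]](scale0r a); exact: tensor_scale.
Qed.

Let tens_addA : associative tens_add.
Proof.
move=> u v w; rewrite -[u]tclass_repr -[v]tclass_repr -[w]tclass_repr.
by rewrite !tens_addE catA.
Qed.

Let tens_addC : commutative tens_add.
Proof. by move=> u v; apply/tclass_eq/tensor_catC. Qed.

Let tens_add0 : left_id (tclass [::]) tens_add.
Proof. by move=> u; rewrite -[u]tclass_repr tens_addE. Qed.

Let tens_addN : left_inverse (tclass [::]) (tens_scale (- 1)) tens_add.
Proof.
move=> u; rewrite -[u]tclass_repr tens_scaleE tens_addE; apply/tclass_eq.
elim: (repr u) => [|[x a] l IHl] /=; first exact: tensor_refl.
set k := tens_scale_seq _ l in IHl *; rewrite -cat_rcons -cats1.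
have step : tensor_rel ([:: (-1 *: x, a)] ++ (k ++ [:: (x, a)]) ++ l)
                       ([:: (-1 *: x, a)] ++ ([:: (x, a)] ++ k) ++ l).
  apply: tensor_cat; first exact: tensor_refl.
  by apply: tensor_cat; [exact: tensor_catC|exact: tensor_refl].
apply: tensor_trans step _.
apply: (@tensor_cat [:: (-1 *: x, a); (x, a)] [::] _ [::]) IHl.
apply: tensor_trans (tensor_zerol a).
by rewrite -(addNr x) -scaleN1r; apply/tensor_sym/tensor_addl.
Qed.

HB.instance Definition _ := GRing.isZmodule.Build tensor
  tens_addA tens_addC tens_add0 tens_addN.

Lemma tclassD l k : tclass l + tclass k = tclass (l ++ k).
Proof. exact: tens_addE. Qed.

Let tens_scaleA r q (u : tensor) :
  tens_scale r (tens_scale q u) = tens_scale (r * q) u.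
Proof.
rewrite -[u]tclass_repr !tens_scaleE; congr tclass.
by rewrite /tens_scale_seq -map_comp; apply: eq_map => -[x a] /=; rewrite scalerA.
Qed.

Let tens_scale1 : left_id 1 tens_scale.
Proof.
move=> u; rewrite -[u]tclass_repr tens_scaleE; congr tclass.
by rewrite -[RHS]map_id; apply: eq_map => -[x a] /=; rewrite scale1r.
Qed.

Let tens_scaleDr : right_distributive tens_scale +%R.
Proof.
move=> r u v; rewrite -[u]tclass_repr -[v]tclass_repr tclassD !tens_scaleE.
by rewrite tclassD /tens_scale_seq map_cat.
Qed.

Let tens_scaleDl u : {morph tens_scale^~ u : r q / r + q}.
Proof.
move=> r q; rewrite -[u]tclass_repr !tens_scaleE tclassD.
elim: (repr u) => [|[x a] l IHl] //.
transitivity (tclass [:: (r *: x, a); (q *: x, a)] +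
  (tclass (tens_scale_seq r l) + tclass (tens_scale_seq q l))).
  rewrite [tclass (tens_scale_seq r l) + _]tclassD -IHl tclassD.
  apply/tclass_eq; rewrite /= scalerDl.
  apply: (@tensor_cat [:: (r *: x + q *: x, a)] [:: (r *: x, a); (q *: x, a)]
    (tens_scale_seq (r + q) l) (tens_scale_seq (r + q) l)).
    exact: tensor_addl.
  exact: tensor_refl.
rewrite -(tclassD [:: _] [:: _]) addrACA -[RHS]tclassD.
by congr (_ + _); exact: tclassD.
Qed.

HB.instance Definition _ := GRing.Zmodule_isLmodule.Build R tensor
  tens_scaleA tens_scale1 tens_scaleDr tens_scaleDl.

Definition tens (x : M) (a : A) : tensor := tclass [:: (x, a)].

Lemma tclassZ r l :
  r *: tclass l = tclass [seq (r *: u.1, u.2) | u <- l].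
Proof. exact: tens_scaleE. Qed.

Lemma tclassE l : tclass l = \sum_(u <- l) tens u.1 u.2.
Proof.
elim: l => [|[x a] l IHl]; first by rewrite big_nil.
by rewrite big_cons -IHl tclassD.
Qed.

Lemma tensDl x y a : tens (x + y) a = tens x a + tens y a.
Proof. by rewrite tclassD; apply/tclass_eq/tensor_addl. Qed.

Lemma tensDr x a b : tens x (a + b) = tens x a + tens x b.
Proof. by rewrite tclassD; apply/tclass_eq/tensor_addr. Qed.

Lemma tensZl r x a : tens (r *: x) a = r *: tens x a.
Proof. by rewrite tclassZ. Qed.

Lemma tensZr r x a : tens x (r *: a) = r *: tens x a.
Proof. by rewrite -tensZl; apply/esym/tclass_eq/tensor_scale. Qed.

(* the universal property; uniqueness of [g] follows from [tclassE] *)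
Lemma tensor_universal (P : lmodType R) (b : M -> A -> P) :
  (forall a, linear (b^~ a)) -> (forall x, linear (b x)) ->
  exists g : {linear tensor -> P}, forall x a, g (tens x a) = b x a.
Proof.
move=> bl br.
have bDl x y a : b (x + y) a = b x a + b y a by have := bl a 1 x y; rewrite !scale1r.
have bDr x a c : b x (a + c) = b x a + b x c by have := br x 1 a c; rewrite !scale1r.
have b0l a : b 0 a = 0 by apply: (addIr (b 0 a)); rewrite -bDl !add0r.
have b0r x : b x 0 = 0 by apply: (addIr (b x 0)); rewrite -bDr !add0r.
have bZl r x a : b (r *: x) a = r *: b x a by have := bl a r x 0; rewrite b0l !addr0.
have bZr r x a : b x (r *: a) = r *: b x a by have := br x r a 0; rewrite b0r !addr0.
pose g (u : tensor) : P := \sum_(v <- repr u) b v.1 v.2.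
have rel_sum l k : tensor_rel l k ->
    \sum_(v <- l) b v.1 v.2 = \sum_(v <- k) b v.1 v.2.
  elim=> {l k}.
  - by [].
  - by move=> l k _ ->.
  - by move=> l k h _ -> _ ->.
  - by move=> l l' k k' _ e _ f; rewrite !big_cat e f.
  - by move=> l k; rewrite !big_cat /= addrC.
  - by rewrite big_seq1 big_nil b0l.
  - by move=> x y a; rewrite big_seq1 big_cons big_seq1 /= bDl.
  - by move=> x a c; rewrite big_seq1 big_cons big_seq1 /= bDr.
  - by move=> r x a; rewrite !big_seq1 /= bZl bZr.
have gE l : g (tclass l) = \sum_(v <- l) b v.1 v.2.
  by apply/rel_sum/tclass_eq; rewrite tclass_repr.
have glin : linear g.
  move=> r u v; rewrite -[u]tclass_repr -[v]tclass_repr tclassZ tclassD !gE.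
  rewrite big_cat big_map scaler_sumr; congr (_ + _).
  by apply: eq_bigr => w _; rewrite /= bZl.
pose gL := GRing.isLinear.Build _ _ _ _ g glin.
pose G : {linear tensor -> P} := HB.pack g gL.
by exists G => x a; rewrite /= gE big_seq1.
Qed.

End Tensor.

Arguments tensor {R} M A.

Section TensorMap.
Variables (R : comPzRingType) (M A B : lmodType R) (f : {linear A -> B}).

(* the map 1_M \otimes f *)
Definition tensor_map (u : tensor M A) : tensor M B :=
  \sum_(v <- repr u) tens v.1 (f v.2).

Lemma tensor_map_tclass l :
  tensor_map (tclass l) = \sum_(v <- l) tens v.1 (f v.2).
Proof.
have [||g gE] := @tensor_universal _ M A (tensor M B) (fun x a => tens x (f a)).
- by move=> a r x y; rewrite tensDl tensZl.
- by move=> x r a b; rewrite linearP tensDr tensZr.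
have gl k : \sum_(v <- k) tens v.1 (f v.2) = g (tclass k).
  by rewrite tclassE raddf_sum; apply: eq_bigr => v _; rewrite /= gE.
by rewrite /tensor_map !gl tclass_repr.
Qed.

Lemma tensor_mapE x a : tensor_map (tens x a) = tens x (f a).
Proof. by rewrite tensor_map_tclass big_seq1. Qed.

Let tensor_map_linear : linear tensor_map.
Proof.
move=> r u v; rewrite -[u]tclass_repr -[v]tclass_repr tclassZ tclassD.
rewrite !tensor_map_tclass big_cat big_map scaler_sumr; congr (_ + _).
by apply: eq_bigr => w _; rewrite /= tensZl.
Qed.

HB.instance Definition _ := GRing.isLinear.Build R (tensor M A) (tensor M B) _
  tensor_map tensor_map_linear.

End TensorMap.

Arguments tensor_map {R} M {A B} f.

Section TauQ.
Variable R : comPzRingType.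

Definition tau_q_mono (A B : lmodType R) (f : {linear A -> B}) : Prop :=
  forall m : q_Max R, injective (loc_map (prime_compl m) f).

Definition tau_q_flat (M : lmodType R) : Prop :=
  forall (A B : lmodType R) (f : {linear A -> B}),
    tau_q_mono f -> tau_q_mono (tensor_map M f).

Definition tau_q_VN_regular : Prop := forall M : lmodType R, tau_q_flat M.

End TauQ.

Definition localization_at (R : comPzRingType) (p : prime_ideal R) :
  comPzRingType := loc_ring (prime_compl p).

Definition von_neumann_regular (R : comPzRingType) : Prop :=
  forall a : R, exists b, a = a * b * a.

Definition reduced (R : comPzRingType) : Prop :=
  forall (a : R) n, a ^+ n = 0 -> a = 0.

(* Main.v *)
(* All five conditions are equivalent to Quentel's condition: for every [a]
   there are finitely many [z_i] with [z_i a = 0] such that the ideal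
   [(a, z_1, ..., z_n)] is dense. Under (3) the ideal of the [x] with
   [x a] in [a^2 R] lies in no maximal q-ideal, hence is semi-regular, which
   gives this condition. Conversely a dense finitely generated ideal lies in
   no maximal q-ideal [m], so [a] or some [z_i] is outside [m] and [R_m] is a
   field; over a field the localization of a tau_q-monomorphism splits, which
   gives (1). By McCoy's theorem a polynomial is regular iff its coefficients
   generate a dense ideal, and if the [z_i] kill all coefficients of [f] then
   [h = f + x^(deg f + 1) (\sum_i z_i x^i)] satisfies [h f = f^2]; this is (4).
   For (5), a prime of a reduced ring is minimal iff each of its elements is
   killed by an element outside it; so limits of ultrafilters of minimal
   primes are minimal, and conversely compactness bounds the number of
   annihilators [z] needed to cover the minimal primes containing [a]. *)

Require Import Defs.
From HB Require Import structures.
From mathcomp Require Import all_boot all_order all_algebra generic_quotient.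
From mathcomp Require Import ring.
From mathcomp Require Import all_classical topology.

Set Implicit Arguments.
Unset Strict Implicit.
Unset Printing Implicit Defensive.

Import GRing.Theory.
Local Open Scope classical_set_scope.
Local Open Scope ring_scope.

Local Notation frac := Defs.frac.

(** * Zorn's lemma and finite subsets of unions of chains *)

(** Zorn's lemma for unions is applied to the sets whose union with [A0] satisfies [P]. The empty
    chain, for which nothing is assumed, then reduces to [P A0]. *)
Lemma Zorn_above T (P : set (set T)) (A0 : set T) : P A0 ->
    (forall F, F !=set0 -> F `<=` P -> total_on F subset ->
      P (\bigcup_(X in F) X)) ->
  exists A, [/\ A0 `<=` A, P A & forall B, P B -> A `<=` B -> B = A].
Proof.
move=> PA0 PU; have [|X [PX maxX]] := @Zorn_bigcup _ [set X | P (A0 `|` X)].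
  move=> F FP totF; have [->|/set0P[Y FY]] := eqVneq F set0.
    by rewrite /= bigcup_set0 setU0.
  rewrite /=.
  have -> : A0 `|` \bigcup_(X in F) X = \bigcup_(X in setU A0 @` F) X.
    rewrite bigcup_image; apply/seteqP; split=> x /=.
      by move=> [A0x|[X FX Xx]]; [exists Y => //; left|exists X => //; right].
    by move=> [X FX [A0x|Xx]]; [left|right; exists X].
  apply: PU; first by exists (A0 `|` Y), Y.
    by move=> _ [X FX <-]; apply: FP.
  move=> _ _ [X FX <-] [X' FX' <-].
  by have [XX'|XX'] := totF _ _ FX FX'; [left|right]; apply: setUS.
exists (A0 `|` X); split=> // B PB AB; apply: contrapT => neB.
have BE : A0 `|` B = B by apply/setUidr/(subset_trans _ AB); left.
apply: (maxX B); last by rewrite /= BE.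
split; first by apply: subset_trans AB; right.
by move=> BX; apply: neB; apply/seteqP; split=> // x /BX; right.
Qed.

(** Lets finitary properties, such as closure under sums or containing a dense finite sequence, be
    checked in a single member of a chain. *)
Lemma chain_seq_sub (T : eqType) (F : set (set T)) (s : seq T) :
    F !=set0 -> total_on F subset -> [set` s] `<=` \bigcup_(X in F) X ->
  exists2 X, F X & [set` s] `<=` X.
Proof.
move=> [Y FY] totF; elim: s => [|x s IHs] sF; first by exists Y.
have [|X FX sX] := IHs; first by move=> y /= ys; apply: sF; rewrite /= inE ys orbT.
have [|X' FX' X'x] := sF x; first by rewrite /= mem_head.
have [XX'|XX'] := totF _ _ FX FX'.
  by exists X' => // y /=; rewrite inE => /predU1P[->//|/sX/XX'].
by exists X => // y /=; rewrite inE => /predU1P[->|/sX//]; apply: XX'.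
Qed.

(** * Dense sequences, maximal q-ideals and Quentel's condition *)

Section Ideals.
Variable R : comPzRingType.
Implicit Types (I J m : set R) (s t : seq R) (a r x y z : R).

Lemma bigcup_ideal (F : set (set R)) : F !=set0 -> total_on F subset ->
  (forall I, F I -> is_ideal I) -> is_ideal (\bigcup_(I in F) I).
Proof.
move=> F0 totF idF; split.
- by have [I FI] := F0; exists I => //; have [] := idF _ FI.
- move=> x y Fx Fy; have [|I FI sI] := @chain_seq_sub _ F [:: x; y] F0 totF.
    by move=> z /=; rewrite !inE => /orP[]/eqP->.
  have [_ ID _] := idF _ FI.
  by exists I => //; apply: ID; apply: sI; rewrite /= !inE eqxx ?orbT.
- move=> r x [I FI Ix]; exists I => //; have [_ _ IM] := idF _ FI.
  exact: IM.
Qed.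

Definition dense_seq s := forall r, (forall x, x \in s -> x * r = 0) -> r = 0.

Lemma dense_seqP s : dense_ideal (ideal_span [set` s]) <-> dense_seq s.
Proof.
rewrite /dense_ideal annihilator_span; split=> [dE r sr|ds].
  by have : annihilator [set` s] r by []; rewrite dE.
by apply/seteqP; split=> [r /ds//|r -> x _]; rewrite mulr0.
Qed.

Lemma semiregularP I : is_ideal I ->
  semiregular I <-> exists2 s, dense_seq s & [set` s] `<=` I.
Proof.
move=> idI; split=> [[_ [[s ->] /dense_seqP ds sI]]|[s ds sI]].
  by exists s => // x xs; apply: sI; apply: sub_ideal_span.
exists (ideal_span [set` s]); split; first by exists s.
  exact/dense_seqP.
exact: ideal_span_min.
Qed.

(** A dense finite sequence in the union of a chain already lies in one member, so Zorn's lemma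
    applies to the non-semi-regular ideals. *)
Lemma sub_max_q_ideal I : is_ideal I -> ~ semiregular I ->
  exists m : q_Max R, I `<=` m.
Proof.
move=> idI nI.
have [//||m [Im [idm nm] maxm]] :=
  @Zorn_above _ [set J : set R | is_ideal J /\ ~ semiregular J] I.
  move=> F F0 FP totF.
  have idU : is_ideal (\bigcup_(J in F) J).
    by apply: bigcup_ideal => // J /FP[].
  split=> // /(semiregularP idU)[s ds sU].
  have [J FJ sJ] := chain_seq_sub F0 totF sU; have [idJ] := FP _ FJ; apply.
  by apply/(semiregularP idJ); exists s.
have maxqm : is_max_q_ideal m by split=> // J idJ nJ; apply: maxm.
by exists (QMax maxqm).
Qed.

Lemma dense_seq_notin (m : q_Max R) s :
  dense_seq s -> exists2 x, x \in s & ~ qmax_set m x.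
Proof.
move=> ds; have [idm nm _] := qmax_setP m; apply: contrapT => sm; apply: nm.
apply/(semiregularP idm); exists s => // x xs.
by apply: contrapT => mx; apply: sm; exists x.
Qed.

Definition quentel_at a : Prop :=
  exists2 t, forall z, z \in t -> z * a = 0 & dense_seq (a :: t).

(** The elements [x - u x * a] kill [a]. If [r] is killed by them and by [a], then x r = u(x) a r =
    0 for every [x] in [s], so r = 0. *)
Lemma quentel_atI a s : dense_seq s ->
  (forall x, x \in s -> exists u, x * a = u * a * a) -> quentel_at a.
Proof.
move=> ds sa; pose u x : R := xget 0 [set u | x * a = u * a * a].
have uE x : x \in s -> x * a = u x * a * a.
  by move=> /sa[v vE]; rewrite /u; case: xgetP => [w _ //|/(_ v)].
exists [seq x - u x * a | x <- s].
  by move=> _ /mapP[x xs ->]; rewrite mulrBl -uE ?subrr.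
move=> r rE; apply: ds => x xs; have := rE (x - u x * a).
rewrite inE (map_f (fun x => x - u x * a)) // orbT => /(_ isT).
by rewrite mulrBl -mulrA (rE a) ?mem_head // mulr0 subr0.
Qed.

(** In the inductive step the products z' z kill both the new element and the old ones. If they, [a]
    and [s] kill [r], then each z' r is killed by [s ++ t], hence is 0, and density of [a :: t']
    gives r = 0. *)
Lemma quentel_seq s : (forall a, quentel_at a) ->
  exists2 t, forall a z, a \in s -> z \in t -> z * a = 0 & dense_seq (s ++ t).
Proof.
move=> Q; elim: s => [|a s [t ts dt]].
  by exists [:: 1] => // r /(_ 1); rewrite mul1r; apply; rewrite mem_head.
have [t' t'a dt'] := Q a; exists [seq z' * z | z' <- t', z <- t].
  move=> b _ + /allpairsP[[z' z] /= [zt' zt ->]]; rewrite inE => /predU1P[->|bs].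
    by rewrite mulrAC t'a ?mul0r.
  by rewrite -mulrA (ts b) ?mulr0.
move=> r rE; apply: (dt') => z'; rewrite inE => /predU1P[->|z't'].
  by apply: rE; rewrite mem_cat mem_head.
apply: (dt) => z; rewrite mem_cat => /orP[zs|zt].
  by rewrite mulrCA rE ?mulr0 // mem_cat inE zs orbT.
rewrite mulrA [z * z']mulrC; apply: rE; rewrite mem_cat; apply/orP; right.
by apply/allpairsP; exists (z', z).
Qed.

Definition locally_regular : Prop :=
  forall (m : q_Max R) a, exists w u, ~ qmax_set m w /\ w * a = u * a * a.

Lemma locally_regular_quentel : locally_regular -> forall a, quentel_at a.
Proof.
move=> reg a; pose I : set R := [set x | exists u, x * a = u * a * a].
have idI : is_ideal I.
  split=> [|x y [u xE] [v yE]|r x [u xE]]; first by exists 0; rewrite !mul0r.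
    by exists (u + v); rewrite !mulrDl xE yE.
  by exists (r * u); rewrite -mulrA xE !mulrA.
have /(semiregularP idI)[s ds sI] : semiregular I.
  apply: contrapT => nI; have [m Im] := sub_max_q_ideal idI nI.
  have [s [u [nms sE]]] := reg m a; have Is : I s by exists u.
  exact/nms/Im.
exact: quentel_atI ds sI.
Qed.

Lemma quentel_locally_regular : (forall a, quentel_at a) -> locally_regular.
Proof.
move=> Q m a; have [t ta dt] := Q a.
have [x] := dense_seq_notin m dt; rewrite inE => /predU1P[->|xt] mx.
  by exists a, 1; rewrite mul1r.
by exists x, 0; rewrite !mul0r ta.
Qed.

Lemma frac_eq0 (S : mulset R) (M : lmodType R) (x : M) (s : set_type S) :
  frac x s = 0 <-> exists2 w, mset S w & w *: x = 0.
Proof.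
rewrite -(frac0 M (den1 S)); split=> [/frac_eq[w Sw]|[w Sw wx]].
  by rewrite den1E scale1r !scaler0; exists w.
by apply/frac_eq; exists w; rewrite // den1E scale1r !scaler0.
Qed.

(** Clears denominators, so that the conditions on R_m and on T(R[x]) both become equations w a = u
    a^2 in the base ring. *)
Lemma von_neumann_regular_locP (S : mulset R) :
  von_neumann_regular (loc_ring S) <->
  forall a, exists w u, mset S w /\ w * a = u * a * a.
Proof.
split=> [VN a|reg c]; last first.
  have [a [s ->]] := fracP c; have [w [u [Sw wE]]] := reg (a : R).
  pose w' : set_type S := exist _ w (mem_set Sw).
  (* From w a = u a^2 one gets (a/s) (u s/w) (a/s) = u a^2/(w s) = a/s. *)
  exists (frac (u * den s : R^o) w'); rewrite !fracM; apply: frac_eq1.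
  rewrite !denME /GRing.scale /=; have -> : den w' = w by [].
  transitivity (den s * den s * (w * (a : R))); first by ring.
  by rewrite wE; ring.
have [c] := VN (frac (a : R^o) (den1 S)); have [b [s ->]] := fracP c.
rewrite !fracM => /frac_eq[w Sw]; rewrite !denME !den1E /GRing.scale /=.
rewrite !mul1r !mulr1 => wE; exists (w * den s), (w * b); split.
  by apply: msetM => //; apply: denP.
by rewrite -mulrA wE; ring.
Qed.

Lemma locally_regularP :
  (forall m : q_Max R, von_neumann_regular (localization_at m)) <->
  locally_regular.
Proof.
by split=> reg m; apply/(von_neumann_regular_locP (prime_compl m))/reg.
Qed.

End Ideals.

(** * Minimal primes of a reduced ring and compactness *)

Section MinimalPrimes.
Variable R : comPzRingType.
Implicit Types (p q : prime_ideal R) (a r s x : R) (T : set R).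

(** Says that the maximal ideal of R_p is zero; in a reduced ring this is minimality of [p]. *)
Definition locally_torsion p : Prop :=
  forall a, prime_set p a -> exists2 s, ~ prime_set p s & s * a = 0.

Lemma reduced_mul_expr s a n : reduced R -> s * a ^+ n = 0 -> s * a = 0.
Proof.
move=> redR sa0; apply: (redR _ n.+1).
by rewrite exprMn exprS exprSr mulrACA sa0 mul0r.
Qed.

Definition mul_closed0 T : Prop :=
  [/\ T 1, forall x y, T x -> T y -> T (x * y) & ~ T 0].

Definition adjoin_powers T a : set R :=
  [set x | exists n, exists2 s, T s & x = s * a ^+ n].

Lemma adjoin_powersP T a : T 1 -> (forall x y, T x -> T y -> T (x * y)) ->
  [/\ T `<=` adjoin_powers T a, adjoin_powers T a a &
    forall x y, adjoin_powers T a x -> adjoin_powers T a y ->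
      adjoin_powers T a (x * y)].
Proof.
move=> T1 TM; split=> [s Ts||_ _ [n [s Ts ->]] [k [t Tt ->]]].
- by exists 0, s; rewrite // expr0 mulr1.
- by exists 1, 1; rewrite // mul1r expr1.
- by exists (n + k)%N, (s * t); [exact: TM|rewrite mulrACA exprD].
Qed.

(** Enlarge [T] to a maximal multiplicative set [S] without 0. If [a] is not in [S], adjoining its
    powers produces s a^n = 0 with [s] in [S], and reducedness gives s a = 0. The complement of [S]
    is thus the set of elements killed by some element of [S], which is an ideal. *)
Lemma prime_avoiding T : reduced R -> mul_closed0 T ->
  exists2 p, T `<=` ~` prime_set p & locally_torsion p.
Proof.
move=> redR T0; have [|S [TS [S1 SM S0] maxS]] := @Zorn_above _ mul_closed0 T T0.
  move=> F F0 FP totF; split.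
  - by have [X FX] := F0; exists X => //; have [] := FP _ FX.
  - move=> x y Fx Fy; have [|X FX sX] := @chain_seq_sub _ F [:: x; y] F0 totF.
      by move=> z /=; rewrite !inE => /orP[]/eqP->.
    have [_ XM _] := FP _ FX.
    by exists X => //; apply: XM; apply: sX; rewrite /= !inE eqxx ?orbT.
  - by move=> [X /FP[]].
have torS a : ~ S a -> exists2 s, S s & s * a = 0.
  move=> nSa; have [SS' S'a S'M] := adjoin_powersP a S1 SM.
  apply: contrapT => nex; apply: nSa.
  rewrite -(maxS (adjoin_powers S a)) //; split=> //; first exact: SS'.
  by move=> [n [s Ss /esym/(reduced_mul_expr redR) sa0]]; apply: nex; exists s.
have primeS : is_prime_ideal (~` S).
  split=> [||x y nSxy]; last 2 first.
  - by apply.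
  - by apply: contrapT => /not_orP[/contrapT Sx /contrapT Sy]; apply: nSxy; apply: SM.
  have tor_notin a s : S s -> s * a = 0 -> (~` S) a.
    by move=> Ss sa0 Sa; apply: S0; rewrite -sa0; apply: SM.
  split=> // [x y /torS[s Ss sx] /torS[t St ty]|r x /torS[s Ss sx]].
    apply: (tor_notin _ (s * t)); first exact: SM.
    by rewrite mulrDr -mulrA mulrCA sx -mulrA ty !mulr0 addr0.
  by apply: (tor_notin _ s); rewrite // mulrCA sx mulr0.
exists (PrimeIdeal primeS) => [x Tx|a /torS[s Ss sa0]] /=; first by apply; apply: TS.
by exists s => //; apply.
Qed.

Lemma locally_torsion_min p : locally_torsion p -> min_primes p.
Proof.
move=> torp q qp; apply/seteqP; split=> // a /torp[s ps sa0].
have [[q0 _ _] _ qM] := prime_setP q.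
by have [/qp//|] : prime_set q s \/ prime_set q a by apply: qM; rewrite sa0.
Qed.

(** If nothing outside [p] kills [a], the complement of [p] together with the powers of [a]
    generates a multiplicative set without 0. A prime avoiding it lies inside [p] and misses [a],
    against minimality. *)
Lemma min_locally_torsion p : reduced R -> min_primes p -> locally_torsion p.
Proof.
move=> redR minp a pa; have [_ p1 pM] := prime_setP p.
have [TS' S'a S'M] := adjoin_powersP a (@prime_compl1 _ p) (@prime_complM _ p).
apply: contrapT => nex.
have [||q Tq _] := @prime_avoiding (adjoin_powers (~` prime_set p) a) => //.
  split=> //; first exact/TS'.
  by move=> [n [s ps /esym/(reduced_mul_expr redR) sa0]]; apply: nex; exists s.
have qp : prime_set q `<=` p by move=> x qx; apply: contrapT => /TS'/Tq.
by have /= := Tq a S'a; rewrite (minp q qp).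
Qed.

Lemma min_prime_exclude r : reduced R -> r <> 0 ->
  exists2 p, ~ prime_set p r & locally_torsion p.
Proof.
move=> redR r0; have [T1 Tr TM] := @adjoin_powersP [set 1] r erefl
  (fun x y (x1 : x = 1) (y1 : y = 1) => etrans (congr2 _ x1 y1) (mulr1 1)).
have [||p Tp torp] := @prime_avoiding (adjoin_powers [set 1] r) => //.
  split=> //; first exact: T1.
  move=> [n [s -> /esym]]; rewrite mul1r => /redR.
  exact: r0.
by exists p => //; apply: Tp.
Qed.

(** If [p] contained all entries of [s], the product of elements outside [p] killing them one by one
    would kill [s], hence be 0, yet lie outside [p]. *)
Lemma locally_torsion_dense p (s : seq R) : locally_torsion p -> dense_seq s ->
  exists2 x, x \in s & ~ prime_set p x.
Proof.
move=> torp ds; have [[p0 _ _] p1 pM] := prime_setP p.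
apply: contrapT => nex.
have [w pw ws] : exists2 w, ~ prime_set p w & forall x, x \in s -> x * w = 0.
  have {nex ds} : forall x, x \in s -> prime_set p x.
    by move=> x xs; apply: contrapT => px; apply: nex; exists x.
  elim: s => [|x s IHs] sp; first by exists 1.
  have [y ys|w pw ws] := IHs; first by apply: sp; rewrite inE ys orbT.
  have [v pv vx] := torp _ (sp x (mem_head _ _)).
  exists (v * w); first exact: (@prime_complM _ p).
  move=> y; rewrite inE => /predU1P[->|ys].
    by rewrite mulrA [x * v]mulrC vx mul0r.
  by rewrite mulrCA ws ?mulr0.
by apply: pw; rewrite (ds w ws).
Qed.

Lemma quentel_reduced : (forall a, quentel_at a) -> reduced R.
Proof.
move=> Q; have sqr0 a : a * a = 0 -> a = 0.
  move=> aa0; have [t ta dt] := Q a; apply: dt => z.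
  by rewrite inE => /predU1P[->|/ta].
move=> a; elim=> [|[|n] IHn] an0.
- by rewrite -[a]mulr1 -(expr0 a) an0 mulr0.
- by rewrite -an0 expr1.
- by apply/IHn/sqr0; rewrite -exprD addnS -addSn addnC exprD an0 mulr0.
Qed.

Lemma quentel_compact : (forall a, quentel_at a) -> compact (@min_primes R).
Proof.
move=> Q; have redR := quentel_reduced Q.
rewrite compact_ultra => F FU Fmin; have FF := @ultra_proper _ F FU.
pose V a : set (prime_ideal R) := [set p | prime_set p a].
have FVC a : ~ F (V a) -> F (~` V a).
  by have [//|] := in_ultra_setVsetC (V a) FU.
(* The candidate limit of [F]: it contains [x] when [F]-almost every prime does. *)
have prime_lim : is_prime_ideal (F \o V).
  split=> [||x y FVxy] /=.
  - split=> [|x y /= Fx Fy|r x /= Fx].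
    + by apply: filterS filterT => p _; have [[]] := prime_setP p.
    + apply: filterS (filterI Fx Fy) => p [px py].
      by have [[_ pD _] _ _] := prime_setP p; apply: pD.
    + by apply: filterS Fx => p px; have [[_ _ pM] _ _] := prime_setP p; apply: pM.
  - move=> F1; apply: (@filter_not_empty _ F); apply: filterS F1 => p.
    by rewrite /V /=; case: (prime_setP p).
  - apply: contrapT => /not_orP[/FVC Fx /FVC Fy].
    apply: (@filter_not_empty _ F); apply: filterS (filterI FVxy (filterI Fx Fy)).
    by move=> p [pxy [px py]]; have [_ _ /(_ x y pxy)[]] := prime_setP p.
pose pF := PrimeIdeal prime_lim.
have torF : locally_torsion pF.
  move=> a FVa; have [t ta dt] := Q a.
  (* Otherwise, [t] being finite, [F]-almost every minimal prime would contain the dense sequence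
     [a :: t], which is impossible for a locally torsion prime. *)
  have [z zt FVz] : exists2 z, z \in t & ~ F (V z); last by exists z; rewrite ?ta.
  apply: contrapT => nex.
  have Ft : F [set p | forall z, z \in t -> prime_set p z].
    have {nex ta dt} : forall z, z \in t -> F (V z).
      by move=> z zt; apply: contrapT => FVz; apply: nex; exists z.
    elim: t => [|z t IHt] tF; first by apply: filterS filterT => p _ z.
    have Ft : F [set p | forall z, z \in t -> prime_set p z].
      by apply: IHt => y yt; apply: tF; rewrite inE yt orbT.
    apply: filterS (filterI (tF z (mem_head _ _)) Ft) => p [pz pt] y.
    by rewrite inE => /predU1P[->//|/pt].
  apply: (@filter_not_empty _ F).
  apply: filterS (filterI Fmin (filterI FVa Ft)) => p [minp [pa pt]].
  have [x] := locally_torsion_dense (min_locally_torsion redR minp) dt.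
  by rewrite inE => /predU1P[->//|/pt].
exists pF; split; first exact: locally_torsion_min.
move=> U; rewrite /= nbhsE => -[_ [[E ->] pFE] EU].
(* One [x] in [E] outside [pF] suffices: [F]-almost every prime misses [x], hence lies in the basic
   open set given by [E]. *)
have /existsNP[x /not_implyP[Ex /FVC Fx]] := pFE.
by apply: filterS Fx => p px; apply: EU => /= /(_ x Ex).
Qed.

(** If the condition fails at [a], the sets [C t] with t a = 0 generate a proper filter. A cluster
    point is a minimal prime containing [a] and every element that kills [a], which contradicts
    local torsion. *)
Lemma compact_quentel : reduced R -> compact (@min_primes R) ->
  forall a, quentel_at a.
Proof.
move=> redR cptR a; apply: contrapT => nQ.
pose C (t : seq R) : set (prime_ideal R) :=
  [set p | min_primes p /\ forall x, x \in a :: t -> prime_set p x].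
pose F : set_system (prime_ideal R) :=
  [set U | exists2 t : seq R, forall z, z \in t -> z * a = 0 & C t `<=` U].
have FF : ProperFilter F.
  split; last split.
  (* If [C t] is empty, [a :: t] is dense: a nonzero [r] killed by it lies outside some minimal
     prime, which must then contain [a :: t]. *)
  - move=> [t ta C0]; apply: nQ; exists t => // r rt; apply: contrapT => r0.
    have [p pr torp] := min_prime_exclude redR r0; apply: (C0 p).
    split=> [|x /rt xr0]; first exact: locally_torsion_min.
    have [[p0 _ _] _ pM] := prime_setP p.
    by have [] // := pM x r; rewrite xr0.
  - by exists [::].
  - move=> U W [t ta tU] [t' t'a t'W]; exists (t ++ t').
      by move=> z; rewrite mem_cat => /orP[/ta|/t'a].
    move=> p [minp pt]; split; [apply: tU|apply: t'W]; split=> // x;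
      rewrite inE => /predU1P[->|xt]; apply: pt;
      by rewrite inE ?eqxx // mem_cat xt ?orbT.
  - by move=> U W UW [t ta tU]; exists t => //; apply: subset_trans UW.
have [|p [minp clp]] := cptR F FF; first by exists [::] => // p [].
have nbhsV x : ~ prime_set p x -> nbhs p [set q | ~ prime_set q x].
  move=> px; rewrite nbhsE; exists [set q : prime_ideal R | ~ ([set x] `<=` q)].
    split; first by exists [set x].
    by move=> /(_ x erefl).
  by move=> q /= xq qx; apply: xq => _ ->.
have meets t x : (forall z, z \in t -> z * a = 0) -> x \in a :: t -> prime_set p x.
  move=> ta xt; apply: contrapT => /nbhsV px.
  have [|q [[_ qt] /(_ (qt x xt))]] //:= clp (C t) _ _ px.
  by exists t.
have pa : prime_set p a by apply: (meets [::]); rewrite ?mem_head.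
have [z pz za0] := min_locally_torsion redR minp pa.
by apply/pz/(meets [:: z]); rewrite ?inE ?eqxx ?orbT // => x; rewrite inE => /eqP->.
Qed.

End MinimalPrimes.

(** * The equation IK = K^2 for finitely generated ideals *)

Section IdealMul.
Variable R : comPzRingType.
Implicit Types (I J K : set R) (s t : seq R) (a r x y : R).

Lemma ideal_mulS I J K : I `<=` J -> ideal_mul I K `<=` ideal_mul J K.
Proof.
move=> IJ; apply: ideal_span_min => [|_ [x Ix [y Ky <-]]].
  exact: ideal_span_ideal.
by apply: sub_ideal_span; exists x; [exact: IJ|exists y].
Qed.

Definition fg_regular : Prop :=
  forall K : set R, fg_ideal K ->
    exists2 I : set R, fg_semiregular I & ideal_mul I K = ideal_mul K K.

(** Take I = K + (t) with [t] killing the generators of [K] and [s ++ t] dense; then (t)K = 0 leaves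
    IK = K^2. *)
Lemma quentel_fg_regular : (forall a, quentel_at a) -> fg_regular.
Proof.
move=> Q _ [s ->]; have [t ts dst] := quentel_seq s Q.
set K := ideal_span _; pose I : set R := ideal_span [set` (s ++ t)].
have idI : is_ideal I by apply: ideal_span_ideal.
have sK : [set` s] `<=` K by apply: sub_ideal_span.
have KI : K `<=` I.
  apply: ideal_span_min => // x xs; apply: sub_ideal_span.
  by rewrite /= mem_cat; apply/orP; left.
exists I.
  split; first by exists (s ++ t).
  by apply/(semiregularP idI); exists (s ++ t) => //; apply: sub_ideal_span.
have [KK0 KKD KKM] : is_ideal (ideal_mul K K) by apply: ideal_span_ideal.
apply/seteqP; split; last exact: ideal_mulS.
apply: ideal_span_min => [//|_ [x Ix [y Ky <-]]].
apply: (ideal_span_min _ _ Ix (I := [set x | ideal_mul K K (x * y)])).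
  split=> [|u v /= uy vy|r u /= uy]; first by rewrite /= mul0r.
  - by rewrite mulrDl; apply: KKD.
  - by rewrite -mulrA; apply: KKM.
move=> u /=; rewrite mem_cat => /orP[us|ut].
  by apply: sub_ideal_span; exists u; [exact: sK|exists y].
suff -> : u * y = 0 by [].
apply: (ideal_span_min _ _ Ky (I := [set y | u * y = 0])) => [|a sa]; last exact: ts.
split=> [|v w /= vu wu|r v /= vu]; first by rewrite /= mulr0.
- by rewrite mulrDr vu wu addr0.
- by rewrite mulrCA vu mulr0.
Qed.

(** For K = aR, the equation IK = K^2 puts x a in a^2 R for all [x] in [I], in particular for the
    entries of a dense sequence in [I]. *)
Lemma fg_regular_quentel : fg_regular -> forall a, quentel_at a.
Proof.
move=> reg a; pose K := ideal_span [set` [:: a]].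
have [|I' [[s ->] smI] IK] := reg K; first by exists [:: a].
set I := ideal_span _ in smI IK.
have [d dd dI] := (semiregularP (ideal_span_ideal _)).1 smI.
have Ka : K a by apply: sub_ideal_span; rewrite /= mem_head.
have KE : K `<=` [set x | exists u, x = u * a].
  apply: ideal_span_min => [|y /=]; last first.
    by rewrite inE => /eqP->; exists 1; rewrite mul1r.
  split=> [|_ _ [u ->] [v ->]|r _ [u ->]]; first by exists 0; rewrite mul0r.
    by exists (u + v); rewrite mulrDl.
  by exists (r * u); rewrite mulrA.
have KKE : ideal_mul K K `<=` [set x | exists u, x = u * a * a].
  apply: ideal_span_min => [|_ [_ /KE[u ->] [_ /KE[v ->] <-]]].
    split=> [|_ _ [u ->] [v ->]|r _ [u ->]]; first by exists 0; rewrite !mul0r.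
      by exists (u + v); rewrite !mulrDl.
    by exists (r * u); rewrite !mulrA.
  by exists (u * v); ring.
apply: quentel_atI dd _ => x /dI Ix; apply: KKE; rewrite -IK.
by apply: sub_ideal_span; exists x => //; exists a.
Qed.

End IdealMul.

(** * Regular polynomials and the total quotient ring of R[x] *)

Section Polynomials.
Variable R : comNzRingType.
Implicit Types (f g h : {poly R}) (a c : R).

(* McCoy's theorem *)
Lemma regular_polyP h : regular h <-> dense_seq (polyseq h).
Proof.
split=> [rh c hc|dh g].
  apply: polyC_inj; apply: rh; apply/polyP => i; rewrite coefMC coef0.
  have [ih|/(nth_default 0)->] := ltnP i (size h); last by rewrite mul0r.
  exact/hc/mem_nth.
have [n] := ubnP (size g); elim: n => // n IHn in g * => gn hg0.
(* Descending induction on [i], inside an induction on the size of [g]. Once h_j g = 0 for all j >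
   i, the coefficient of h g at i + deg g is h_i times the leading coefficient of [g]. So h_i g is
   shorter than [g], and as [h] kills it too, it is 0. *)
have hig0 i : h`_i *: g = 0.
  have [k] := ubnP (size h - i); elim: k i => // k IHk i ik.
  have hjg0 j : (i < j)%N -> h`_j *: g = 0.
    move=> ij; have [jh|/(nth_default 0)->] := ltnP j (size h); last first.
      by rewrite scale0r.
    by apply: IHk; apply: leq_trans (ltn_sub2l (ltn_trans ij jh) ij) ik.
  have [->|g0] := eqVneq g 0; first by rewrite scaler0.
  apply: IHn; last by rewrite -scalerAr hg0 scaler0.
  have dE : (size g).-1.+1 = size g by rewrite prednK // size_poly_gt0.
  have gcoef j : ((size g).-1 < j)%N -> g`_j = 0.
    by rewrite dE => /(nth_default 0).
  rewrite ltnS in gn; apply: leq_trans gn; rewrite -dE !ltnS.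
  apply/leq_sizeP => j; rewrite leq_eqVlt => /predU1P[<-|gj]; last first.
    by rewrite coefZ gcoef ?mulr0.
  have := congr1 (fun p : {poly R} => p`_(i + (size g).-1)) hg0.
  have iP : (i < (i + (size g).-1).+1)%N by rewrite ltnS leq_addr.
  rewrite coef0 coefM (bigD1 (Ordinal iP)) //= addKn coefZ big1 ?addr0 // => l.
  rewrite -val_eqE /= neq_ltn => /orP[li|il].
    by rewrite gcoef ?mulr0 // ltn_subRL ltn_add2r.
  by rewrite -coefZ hjg0 ?coef0.
apply/polyP => i; rewrite coef0; apply: dh => _ /(nthP 0)[j jh <-].
by rewrite -coefZ hig0 coef0.
Qed.

Lemma quentel_poly : (forall a : R, quentel_at a) ->
  von_neumann_regular (total_quotient_ring {poly R}).
Proof.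
move=> Q; apply/(von_neumann_regular_locP (regular_mulset {poly R})) => f.
have [t tf dft] := quentel_seq (polyseq f) Q; pose z := Poly t.
have zf0 : z * f = 0.
  apply/polyP => k; rewrite coefM coef0 big1 // => i _; rewrite coef_Poly.
  have [it|/(nth_default 0)->] := ltnP i (size t); last by rewrite mul0r.
  have [jf|/(nth_default 0)->] := ltnP (k - i) (size f); last by rewrite mulr0.
  by apply: tf; apply: mem_nth.
(* The shift by [size f] keeps the coefficients of [f] and [z] apart, so whatever the coefficients
   of [h] kill is killed by those of both. *)
pose h := f + 'X^(size f) * z; exists h, 1; split; last first.
  by rewrite mul1r mulrDl -mulrA zf0 mulr0 addr0.
apply/regular_polyP => r rh.
have coefh k : h`_k * r = 0.
  have [kh|/(nth_default 0)->] := ltnP k (size h); last by rewrite mul0r.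
  exact/rh/mem_nth.
apply: dft => x; rewrite mem_cat => /orP[] /(nthP 0)[k kx <-].
  by have := coefh k; rewrite coefD coefXnM kx addr0.
have := coefh (size f + k)%N; rewrite coefD coefXnM ltnNge leq_addr addKn /=.
by rewrite nth_default ?leq_addr // add0r coef_Poly.
Qed.

(** Comparing coefficients in w a = u a^2 gives w_i a = u_i a^2 in [R], and the w_i form a dense
    sequence because [w] is regular. *)
Lemma poly_quentel :
  von_neumann_regular (total_quotient_ring {poly R}) ->
  forall a : R, quentel_at a.
Proof.
move=> /(von_neumann_regular_locP (regular_mulset {poly R})) reg a.
have [w [u [/regular_polyP dw wE]]] := reg a%:P.
apply: quentel_atI dw _ => _ /(nthP 0)[i _ <-]; exists u`_i.
by rewrite -coefMC wE !coefMC.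
Qed.

End Polynomials.

(** * Splitting of injections after localization to a field *)

Section LocalizedModule.
Variables (R : comPzRingType) (S : mulset R).

Lemma loc_map_injP (A B : lmodType R) (f : {linear A -> B}) :
  injective (loc_map S f) <->
  forall (x : A) w, mset S w -> w *: f x = 0 -> exists2 v, mset S v & v *: x = 0.
Proof.
split=> [injf x w Sw wfx|injf].
  apply/(frac_eq0 x (den1 S))/injf; rewrite raddf0 loc_mapE.
  by apply/frac_eq0; exists w.
apply: raddf_inj => c; have [x [s ->]] := fracP c.
rewrite [X in X = 0 -> _](loc_mapE f x s).
by move=> /frac_eq0[w Sw /(injf _ _ Sw)] /frac_eq0.
Qed.

(* [loc S M] as a module over [R] by restriction of scalars *)
Definition loc_res (M : lmodType R) : Type := loc S M.

Section Restriction.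
Variable M : lmodType R.
HB.instance Definition _ := GRing.Zmodule.on (loc_res M).

Let scale (r : R) (c : loc_res M) : loc_res M :=
  (frac (r : R^o) (den1 S) : loc_ring S) *: (c : loc S M).

Let scaleE r x s : scale r (frac x s) = frac (r *: x) s.
Proof.
rewrite /scale fracZ; apply: frac_eq1.
by rewrite denME den1E mul1r.
Qed.

Let scaleA r q c : scale r (scale q c) = scale (r * q) c.
Proof. by have [x [s ->]] := fracP c; rewrite !scaleE scalerA. Qed.

Let scale1 : left_id 1 scale.
Proof. by move=> c; have [x [s ->]] := fracP c; rewrite scaleE scale1r. Qed.

Let scaleDr : right_distributive scale +%R.
Proof. by move=> r c d; rewrite /scale scalerDr. Qed.

Let scaleDl c : {morph scale^~ c : r q / r + q}.
Proof.
move=> r q; rewrite /scale -scalerDl; congr (_ *: _).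
by rewrite fracD den1E !scale1r; apply: frac_eq1; rewrite denME den1E mulr1.
Qed.

HB.instance Definition _ := GRing.Zmodule_isLmodule.Build R (loc_res M)
  scaleA scale1 scaleDr scaleDl.

Lemma loc_resZ r x s : r *: (frac x s : loc_res M) = frac (r *: x) s.
Proof. exact: scaleE. Qed.

Lemma loc_resD x y s : (frac x s : loc_res M) + frac y s = frac (x + y) s.
Proof.
rewrite [LHS]fracD; apply: frac_eq1.
by rewrite denME -scalerDr scalerA.
Qed.

End Restriction.

Definition is_submodule (B : lmodType R) (W : set B) : Prop :=
  [/\ W 0, forall x y, W x -> W y -> W (x + y) & forall r x, W x -> W (r *: x)].

Lemma bigcup_submodule (B : lmodType R) (F : set (set B)) : F !=set0 ->
  total_on F subset -> (forall W, F W -> is_submodule W) ->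
  is_submodule (\bigcup_(W in F) W).
Proof.
move=> F0 totF subF; split.
- by have [W FW] := F0; exists W => //; have [] := subF _ FW.
- move=> x y Fx Fy; have [|W FW sW] := @chain_seq_sub _ F [:: x; y] F0 totF.
    by move=> z /=; rewrite !inE => /orP[]/eqP->.
  have [_ WD _] := subF _ FW.
  by exists W => //; apply: WD; apply: sW; rewrite /= !inE eqxx ?orbT.
- move=> r x [W FW Wx]; exists W => //; have [_ _ WZ] := subF _ FW.
  exact: WZ.
Qed.

Hypothesis field_loc : forall r, mset S r \/ exists2 w, mset S w & w * r = 0.

Section Retraction.
Variables (A B : lmodType R) (f : {linear A -> B}).
Hypothesis injf : injective (loc_map S f).

Let torsion (a : A) : Prop := exists2 w, mset S w & w *: a = 0.

(** After localization [W] is a complement of the image of [f]. It is chosen maximal among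
    submodules that meet this image only in images of torsion elements. If adding [b] breaks this,
    some f a - r b is in [W] with [a] not torsion. Then [r] is in [S]: from w r = 0 it would follow
    that f(w a) is in [W] and [a] is torsion. *)
Lemma exists_loc_complement : exists W : set B, [/\ is_submodule W,
  forall a, W (f a) -> torsion a &
  forall b, exists s a, mset S s /\ W (s *: b - f a)].
Proof.
have /loc_map_injP injf' := injf.
pose P (W : set B) := is_submodule W /\ forall a, W (f a) -> torsion a.
have [||W [_ [subW Wtor] maxW]] := @Zorn_above _ P [set 0].
- split=> [|a fa0]; last by apply: (injf' a 1 (mset1 S)); rewrite fa0 scaler0.
  split=> // [x y -> ->|r x ->]; first by rewrite /= addr0.
  by rewrite /= scaler0.
- move=> F F0 FP totF; split; first by apply: bigcup_submodule => // W /FP[].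
  by move=> a [W /FP[_]]; apply.
exists W; split=> // b; have [W0 WD WZ] := subW.
pose W' : set B := [set x | exists r, W (x - r *: b)].
have subW' : is_submodule W'.
  split=> [|x y [r Wx] [q Wy]|q x [r Wx]].
  - by exists 0; rewrite scale0r subrr.
  - by exists (r + q); rewrite scalerDl opprD addrACA; apply: WD.
  - by exists (q * r); rewrite -scalerA -scalerBr; apply: WZ.
have WW' : W `<=` W' by move=> x Wx; exists 0; rewrite scale0r subr0.
have [/(conj subW')/maxW/(_ WW') W'E|] :=
    pselect (forall a, W' (f a) -> torsion a).
  exists 1, 0; split; first exact: mset1.
  by rewrite raddf0 subr0 scale1r -W'E; exists 1; rewrite scale1r subrr.
move=> /existsNP[a /not_implyP[[r Wa] ntor]].
have [Sr|[w Sw wr0]] := field_loc r.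
  by exists r, a; split=> //; rewrite -opprB -scaleN1r; apply: WZ.
case: ntor; have [|v Sv va0] := Wtor (w *: a).
  by move: Wa => /(WZ w); rewrite scalerBr scalerA wr0 scale0r subr0 -linearZ.
by exists (v * w); [exact: msetM|rewrite -scalerA].
Qed.

(* By [field_loc], [loc_ring S] is a field (or zero), so the injective
   localization of [f] splits. *)
Lemma exists_loc_retraction : exists g : {linear B -> loc_res A},
  forall a, g (f a) = frac a (den1 S).
Proof.
have fZ r x : f (r *: x) = r *: f x by rewrite linearZ.
have [W [[W0 WD WZ] Wtor Wspan]] := exists_loc_complement.
(* The projection along [W] sends [b] to a/s when s b - f a is in [W]; it is single-valued because
   [W] meets the image of [f] only in images of torsion elements. *)
pose graph b (c : loc_res A) := exists a s, c = frac a s /\ W (den s *: b - f a).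
have graph_ex b : exists c, graph b c.
  have [s [a [Ss Wsa]]] := Wspan b.
  by exists (frac a (exist _ s (mem_set Ss))); exists a, (exist _ s (mem_set Ss)).
have graph_uniq b c c' : graph b c -> graph b c' -> c = c'.
  move=> [a [s [-> Ws]]] [a' [s' [-> Ws']]].
  have [|w Sw w0] := Wtor (den s' *: a - den s *: a').
    have := WD _ _ (WZ (den s) _ Ws') (WZ (- den s') _ Ws).
    rewrite scaleNr -scalerN opprB !scalerBr !scalerA [den s * _]mulrC.
    by rewrite addrC addrA subrK (linearB f) !fZ.
  apply/frac_eq; exists w => //.
  by apply/eqP; rewrite -subr_eq0 -scalerBr w0.
have /choice[g gP] := graph_ex.
have glin : linear g.
  move=> r b b'; apply: graph_uniq (gP _) _.
  have [a [s [-> Ws]]] := gP b; have [a' [s' [-> Ws']]] := gP b'.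
  exists (den s' *: (r *: a) + den s *: a'), (denM s s').
  split; first by rewrite loc_resZ [LHS]fracD.
  suff -> : den (denM s s') *: (r *: b + b')
      - f (den s' *: (r *: a) + den s *: a')
      = (r * den s') *: (den s *: b - f a) + den s *: (den s' *: b' - f a').
    by apply: WD; apply: WZ.
  rewrite (linearD f) !fZ denME !scalerDr !scalerN !scalerA opprD addrACA.
  by congr (_ *: _ - _ *: _ + _); ring.
pose gL := GRing.isLinear.Build _ _ _ _ g glin.
pose G : {linear B -> loc_res A} := HB.pack g gL.
exists G => a; apply: graph_uniq (gP _) _.
by exists a, (den1 S); split=> //; rewrite den1E scale1r subrr.
Qed.

End Retraction.

(** The retraction [g] induces a map [h] from the tensor product of [M] and [B], with value x tensor
    g(y) at x tensor y. Its composite with [tensor_map M f] is the canonical map to the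
    localization, whose kernel is torsion. *)
Lemma tensor_map_loc_inj (M A B : lmodType R) (f : {linear A -> B}) :
  injective (loc_map S f) -> injective (loc_map S (tensor_map M f)).
Proof.
move=> injf; have [g gE] := exists_loc_retraction injf.
have tens_lin (x : M) : linear (@tens R M A x).
  by move=> r a a'; rewrite tensDr tensZr.
pose tl x := GRing.isLinear.Build _ _ _ _ (@tens R M A x) (tens_lin x).
pose T x : {linear A -> tensor M A} := HB.pack (@tens R M A x) (tl x).
pose b x y : loc_res (tensor M A) := loc_map S (T x) (g y).
have bE x a s : loc_map S (T x) (frac a s) = frac (tens x a) s.
  exact: loc_mapE.
have [||h hE] := @tensor_universal _ M B _ b.
- move=> y r x x'; rewrite /b; have [a [s ->]] := fracP (g y).
  by rewrite !bE loc_resZ loc_resD tensDl tensZl.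
- move=> x r y y'; rewrite /b linearP.
  rewrite raddfD /=; congr (_ + _).
  have [a [s ->]] := fracP (g y).
  by rewrite loc_resZ !bE loc_resZ tensZr.
have hfE u : h (tensor_map M f u) = frac u (den1 S).
  rewrite -[u]tclass_repr tensor_map_tclass tclassE.
  elim: (repr u) => [|v l IHl]; first by rewrite !big_nil raddf0 frac0.
  by rewrite !big_cons (linearD h) hE IHl -loc_resD /b gE bE.
apply/loc_map_injP => u w Sw wu0.
have : frac (w *: u) (den1 S) = 0 :> loc_res _.
  by rewrite -hfE linearZ /= wu0 raddf0.
by move=> /frac_eq0[v Sv vw0]; exists (v * w); [exact: msetM|rewrite -scalerA].
Qed.

End LocalizedModule.

(** * The cyclic module R/I and maps out of it *)

Section QuotientModule.
Variables (R : comPzRingType) (I : set R).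

Definition ideal_pred (idI : is_ideal I) : {pred R} := fun x => `[< I x >].

Variable idI : is_ideal I.

Let ideal_pred_closed : zmod_closed (ideal_pred idI).
Proof.
have [I0 ID IM] := idI; split=> [|x y /asboolP Ix /asboolP Iy]; apply/asboolP => //.
by apply: ID => //; rewrite -mulN1r; apply: IM.
Qed.

HB.instance Definition _ :=
  GRing.isZmodClosed.Build R (ideal_pred idI) ideal_pred_closed.

Definition quot_module : Type := {ideal_quot (ideal_pred idI)}.
HB.instance Definition _ := GRing.Zmodule.on quot_module.

Definition quot_proj (x : R) : quot_module :=
  (\pi_({ideal_quot (ideal_pred idI)}) x)%qT.

Lemma quot_projP x y : quot_proj x = quot_proj y <-> I (x - y).
Proof.
rewrite /quot_proj; split=> [/eqP|Ixy].
  by rewrite -Quotient.idealrBE => /asboolP.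
by apply/eqP; rewrite -Quotient.idealrBE; apply/asboolP.
Qed.

Lemma quot_proj_surj u : exists x, u = quot_proj x.
Proof. by exists (repr u); rewrite /quot_proj reprK. Qed.

Lemma quot_proj_repr x : I (repr (quot_proj x) - x).
Proof. by apply/quot_projP; rewrite /quot_proj reprK. Qed.

Lemma quot_projD x y : quot_proj x + quot_proj y = quot_proj (x + y).
Proof. by rewrite /quot_proj !piE. Qed.

Lemma quot_proj0 : quot_proj 0 = 0.
Proof. by apply: (addrI (quot_proj 0)); rewrite quot_projD !addr0. Qed.

Let scale (r : R) (u : quot_module) : quot_module := quot_proj (r * repr u).

Let scaleE r x : scale r (quot_proj x) = quot_proj (r * x).
Proof.
apply/quot_projP; rewrite -mulrBr; have [_ _ IM] := idI.
exact/IM/quot_proj_repr.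
Qed.

Let scaleA r q u : scale r (scale q u) = scale (r * q) u.
Proof. by have [x ->] := quot_proj_surj u; rewrite !scaleE mulrA. Qed.

Let scale1 : left_id 1 scale.
Proof. by move=> u; have [x ->] := quot_proj_surj u; rewrite scaleE mul1r. Qed.

Let scaleDr : right_distributive scale +%R.
Proof.
move=> r u v; have [x ->] := quot_proj_surj u; have [y ->] := quot_proj_surj v.
by rewrite quot_projD !scaleE quot_projD mulrDr.
Qed.

Let scaleDl u : {morph scale^~ u : r q / r + q}.
Proof.
move=> r q; have [x ->] := quot_proj_surj u.
by rewrite !scaleE quot_projD mulrDl.
Qed.

HB.instance Definition _ := GRing.Zmodule_isLmodule.Build R quot_module
  scaleA scale1 scaleDr scaleDl.

Lemma quot_projZ r x : r *: quot_proj x = quot_proj (r * x).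
Proof. exact: scaleE. Qed.

Lemma quot_proj_lift (P : lmodType R) (h : R -> P) :
    (forall r x y, h (r * x + y) = r *: h x + h y) ->
    (forall x, I x -> h x = 0) ->
  exists g : {linear quot_module -> P}, forall x, g (quot_proj x) = h x.
Proof.
move=> hlin hI; pose g (u : quot_module) := h (repr u).
have gE x : g (quot_proj x) = h x.
  rewrite /g -[repr _](subrK x) -[repr _ - x]mul1r hlin hI ?scaler0 ?add0r //.
  exact: quot_proj_repr.
have glin : linear g.
  move=> r u v; have [x ->] := quot_proj_surj u; have [y ->] := quot_proj_surj v.
  by rewrite quot_projZ quot_projD !gE hlin.
pose gL := GRing.isLinear.Build _ _ _ _ g glin.
pose G : {linear quot_module -> P} := HB.pack g gL.
by exists G.
Qed.

End QuotientModule.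

(** * Flatness and regularity at the maximal q-ideals *)

Section Flatness.
Variable R : comPzRingType.

Lemma locally_regular_tau_q_VN : locally_regular R -> tau_q_VN_regular R.
Proof.
move=> reg M A B f injf m; apply: tensor_map_loc_inj => // a.
have [[_ mD mM] _ mP] := max_q_ideal_prime (qmax_setP m).
have [ma|] := pselect (qmax_set m a); [right|by left].
have [w [u [mw wE]]] := reg m a.
(* This element kills [a], and it stays outside [m] because [a] is in [m] and [w] is not. *)
exists (w - u * a); last by rewrite mulrBl wE subrr.
by move=> /= mwa; apply: mw; rewrite -[w](subrK (u * a)); apply/mD/mM.
Qed.

(* Tensoring [R / ann a -> R], [1 |-> a], with [R / aR] gives the zero map, while
   [R / aR \otimes R / ann a] is [R / (aR + ann a)]. *)
Lemma tau_q_VN_locally_regular : tau_q_VN_regular R -> locally_regular R.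
Proof.
move=> VN m a.
pose I1 : set R := [set x | exists u, x = u * a].
pose I2 : set R := [set x | x * a = 0].
(* This is aR + ann a, and [w] lies in it exactly when w a = u a^2 for some [u]. *)
pose J : set R := [set x | exists u, (x - u * a) * a = 0].
have id1 : is_ideal I1.
  split=> [|_ _ [u ->] [v ->]|r _ [u ->]]; first by exists 0; rewrite mul0r.
    by exists (u + v); rewrite mulrDl.
  by exists (r * u); rewrite mulrA.
have id2 : is_ideal I2.
  split=> [|x y xa ya|r x xa]; first by rewrite /I2 /= mul0r.
    by rewrite /I2 /= mulrDl xa ya addr0.
  by rewrite /I2 /= -mulrA xa mulr0.
have idJ : is_ideal J.
  split=> [|x y [u xE] [v yE]|r x [u xE]].
  - by exists 0; rewrite !mul0r subrr mul0r.
  - by exists (u + v); rewrite -[RHS]addr0 -{1}xE -yE; ring.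
  - by exists (r * u); rewrite -mulrA -mulrBr -mulrA xE mulr0.
have I1J x : I1 x -> J x by move=> [u ->]; exists u; rewrite subrr mul0r.
have I2J x : I2 x -> J x by move=> xa; exists 0; rewrite mul0r subr0.
have [||f fE] := @quot_proj_lift R I2 id2 R^o (fun x => x * a).
- by move=> r x y; rewrite mulrDl -mulrA.
- by [].
have injf : tau_q_mono f.
  move=> p; apply/loc_map_injP => c w pw; have [x ->] := quot_proj_surj c.
  rewrite fE => wxa; exists w => //.
  rewrite quot_projZ -(quot_proj0 id2).
  by apply/quot_projP; rewrite subr0 /I2 /= -mulrA.
have /loc_map_injP inj := VN (quot_module id1) _ _ f injf m.
(* The image of 1 tensor 1 is 1 tensor a = a tensor 1 = 0, so some [w] outside [m] kills 1 tensor 1.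
   Mapping to R/J below turns this into membership of [w] in [J]. *)
have [||w mw w0] := inj (tens (quot_proj id1 1) (quot_proj id2 1)) 1.
- by have [] := max_q_ideal_prime (qmax_setP m).
- rewrite scale1r; apply: etrans (tensor_mapE f _ _) _; rewrite fE mul1r.
  have -> : a = a *: (1 : R^o) by rewrite /GRing.scale /= mulr1.
  rewrite tensZr -tensZl quot_projZ.
  have -> : quot_proj id1 (a * 1) = 0.
    by rewrite -(quot_proj0 id1); apply/quot_projP; exists 1; ring.
  by rewrite -[X in tens X](scale0r 0) tensZl scale0r.
pose b (u : quot_module id1) (v : quot_module id2) :=
  quot_proj idJ (repr u * repr v).
have bE x y : b (quot_proj id1 x) (quot_proj id2 y) = quot_proj idJ (x * y).
  have [_ JD JM] := idJ; apply/quot_projP.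
  set x' := repr _; set y' := repr _.
  have -> : x' * y' - x * y = y' * (x' - x) + x * (y' - y) by ring.
  apply: JD; apply: JM; first exact: I1J (quot_proj_repr id1 x).
  exact: I2J (quot_proj_repr id2 y).
have [||g gE] := tensor_universal _ _ (b := b).
- move=> v r u u'; have [y ->] := quot_proj_surj v.
  have [x ->] := quot_proj_surj u; have [x' ->] := quot_proj_surj u'.
  rewrite quot_projZ quot_projD !bE quot_projZ quot_projD.
  by congr quot_proj; ring.
- move=> u r v v'; have [x ->] := quot_proj_surj u.
  have [y ->] := quot_proj_surj v; have [y' ->] := quot_proj_surj v'.
  rewrite quot_projZ quot_projD !bE quot_projZ quot_projD.
  by congr quot_proj; ring.
have : w *: g (tens (quot_proj id1 1) (quot_proj id2 1)) = 0.
  by rewrite -linearZ /= w0 raddf0.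
rewrite gE bE quot_projZ !mulr1 -(quot_proj0 idJ) => /quot_projP.
rewrite subr0 => -[u /eqP]; rewrite mulrBl subr_eq0 => /eqP wE.
by exists w, u.
Qed.

End Flatness.

Theorem theorem4p9 (R : comNzRingType) :
  [<-> tau_q_VN_regular R;
       forall K : set R, fg_ideal K ->
         exists2 I : set R, fg_semiregular I & ideal_mul I K = ideal_mul K K;
       forall m : q_Max R, von_neumann_regular (localization_at m);
       von_neumann_regular (total_quotient_ring {poly R});
       reduced R /\ compact (min_primes (R := R))].
Proof.
tfae.
- by move=> /tau_q_VN_locally_regular/locally_regular_quentel/quentel_fg_regular.
- by move=> /fg_regular_quentel/quentel_locally_regular/locally_regularP.
- by move=> /locally_regularP/locally_regular_quentel/quentel_poly.
- move=> /poly_quentel Q; split; first exact: quentel_reduced.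
  exact: quentel_compact.
- move=> [redR cptR]; apply/locally_regular_tau_q_VN/quentel_locally_regular.
  exact: compact_quentel.
Qed.
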